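(* Let $(V,\Sigma,\nu)$ be an infinite measure space of voters with $\nu$ atomless and $\nu(V)=1$, and let $C=\{c_1,c_2,c_3\}$ be a set of three candidates. Then there exists a strongly non-Borda social welfare function on $V$ and $C$ which satisfies all of U (unrestricted domain), MIIA, A (anonymity), N (neutrality), P (Pareto), PR (positive responsiveness) and IV (intermediate value).
   Context: Setting. $k=|C|$ (here $k=3$). $\mathfrak{R}$ is the set of bijections $r:C\to\{0,\dots,k-1\}$ (rankings; a larger value means ranked higher), with the discrete $\sigma$-algebra. An election is a measurable $e:V\to\mathfrak{R}$. $\mathfrak{R}_=$ is the set of weak orderings $\succ$ of $C$ (an equivalence relation of tying together with a total order of winning on the classes; $c_i\succ c_j$ means $c_i$ strictly beats $c_j$). A social welfare function (SWF) is a function $F:E\to\mathfrak{R}_=$, where $E$ is a set of elections. For $i\neq j$: $\pi_{i,j}(r)=r(c_i)-r(c_j)\in D_k=\{1-k,\dots,-1,1,\dots,k-1\}$; for $e\in E$, $\pi_{i,j}(e):V\to D_k$ is $v\mapsto\pi_{i,j}(e(v))$; $A_{i,j}=\pi_{i,j}(E)$; for $\succ\in\mathfrak{R}_=$, $\pi_{i,j}(\succ)=W$ if $c_i\succ c_j$, $L$ if $c_j\succ c_i$, $T$ otherwise. Order: $W>T>L$. Promotion: for rankings $r_1,r_2$ and $c_i\ne c_j$, $(c_j,c_i)$ is promoted by $(r_2,r_1)$ if for all candidates $c_m,c_\ell\notin\{c_i,c_j\}$: (i) $r_1(c_m)>r_1(c_i)\Rightarrow r_2(c_m)>r_2(c_i)$;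 (ii) $r_1(c_j)>r_1(c_m)\Rightarrow r_2(c_j)>r_2(c_m)$; (iii) $r_1(c_j)>r_1(c_i)\Rightarrow r_2(c_j)>r_2(c_i)$; (iv) $r_1(c_m)>r_1(c_\ell)\Leftrightarrow r_2(c_m)>r_2(c_\ell)$. For elections, $(c_j,c_i)$ is promoted by $(e_2,e_1)$ if it is promoted by $(e_2(v),e_1(v))$ for every $v\in V$. Conditions on $F$: - U: $E$ is the set of all measurable functions $V\to\mathfrak{R}$. - MIIA: for all $i\ne j$ there is $f_{i,j}:A_{i,j}\to\{W,T,L\}$ with $f_{i,j}(\pi_{i,j}(e))=\pi_{i,j}(F(e))$ for all $e\in E$. - A: $F(e)$ depends only on $\tau(e)\in\mathbb{R}_{\ge0}^{\mathfrak{R}}$, $\tau(e)(r)=\nu(e^{-1}(r))$. - N: for every permutation $\rho$ of $C$ and all $e\in E$ with $\rho\circ e\in E$, $F(\rho\circ e)=\rho(F(e))$. Here $(\rho\circ e)(v)=\rho(e(v))$ with $\rho(r)=r\circ\rho^{-1}$, and $\rho(\succ)$ is the weak ordering in which $\rho(c_i)$ beats $\rho(c_j)$ iff $c_i\succ c_j$. - P: if $\pi_{i,j}(e)(v)>0$ for all $v\in V$ then $\pi_{i,j}(F(e))=W$. - PR: whenever $(c_j,c_i)$ is promoted by $(e_2,e_1)$, $\pi_{i,j}(F(e_1))\ge\pi_{i,j}(F(e_2))$. - IV: whenever $(c_j,c_i)$ is promoted by $(e_2,e_1)$, $\pi_{i,j}(F(e_1))=W$ and $\pi_{i,j}(F(e_2))=L$,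 there is $e'\in E$ such that $(c_j,c_i)$ is promoted by both $(e',e_1)$ and $(e_2,e')$, and $\pi_{i,j}(F(e'))=T$. Borda rules: for an integrable weight function $w:V\to\mathbb{R}$, the Borda rule $B_w$ is the SWF ranking candidates by the score $b_w(c,e)=\int_V e(v)(c)\,w(v)\,d\nu(v)$ (i.e. $c_i$ beats $c_j$ iff $b_w(c_i,e)>b_w(c_j,e)$). The tie rule is the SWF under which all candidates are always tied (the case $w\equiv0$). $F$ is weakly Borda if there is $w$, not almost everywhere zero (i.e. $B_w$ is not the tie rule), such that for all $e\in E$ and $i\neq j$, $\pi_{i,j}(B_w(e))\neq T$ implies $\pi_{i,j}(F(e))=\pi_{i,j}(B_w(e))$. $F$ is strongly non-Borda if it is neither weakly Borda nor the tie rule. *)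

(* Defs.v *)
From HB Require Import structures.
From mathcomp Require Import all_boot all_order all_fingroup all_algebra.
From mathcomp Require Import all_classical all_reals all_analysis.

Set Implicit Arguments.
Unset Strict Implicit.
Unset Printing Implicit Defensive.

Import Order.TTheory GRing.Theory Num.Theory.
Local Open Scope classical_set_scope.
Local Open Scope ring_scope.

(* Candidates are the elements of 'I_k.  Since |C| = k, the bijections
   C -> {0, ..., k-1} are the permutations of 'I_k; [r c] is the value given to
   candidate [c], and a larger value means ranked higher. *)
Definition ranking (k : nat) := {perm 'I_k}.

HB.instance Definition _ k := Finite.on (ranking k).
HB.instance Definition _ k := isPointed.Build (ranking k) (perm_one 'I_k).
HB.instance Definition _ k := @isMeasurable.Build default_measure_display
  (ranking k) discrete_measurable discrete_measurable0
  discrete_measurableC discrete_measurableU.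

(* [beats] is a strict total order on the classes of [tied]: by [beats_tied] it
   descends to the quotient. *)
Record weak_ordering (k : nat) := WeakOrdering {
  tied : rel 'I_k;
  beats : rel 'I_k;
  tied_equiv : equivalence_rel tied;
  beats_tied : forall a a' b b',
    tied a a' -> tied b b' -> beats a b = beats a' b';
  beats_irr : irreflexive beats;
  beats_trans : transitive beats;
  beats_total : forall a b, ~~ tied a b -> beats a b || beats b a }.

Program Definition score_ordering (R : realType) (k : nat) (s : 'I_k -> R) :
    weak_ordering k :=
  {| tied := fun a b => s a == s b; beats := fun a b => s b < s a |}.
Next Obligation.
by move=> R k s a b c; split; [exact: eqxx | move/eqP ->].
Qed.
Next Obligation. by move=> R k s a a' b b' /= /eqP -> /eqP ->. Qed.
Next Obligation. by move=> R k s a /=; rewrite ltxx. Qed.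
Next Obligation. by move=> R k s b a c /= ba cb; exact: lt_trans cb ba. Qed.
Next Obligation. by move=> R k s a b /=; rewrite neq_lt orbC. Qed.

(* A permutation [rho] of the candidates sends [r] to r o rho^-1; in {perm _},
   [(s * t)%g c = t (s c)]. *)
Definition permute_ranking (k : nat) (rho : {perm 'I_k}) (r : ranking k) :
  ranking k := (rho^-1 * r)%g.

Program Definition permute_ordering (k : nat) (rho : {perm 'I_k})
    (x : weak_ordering k) : weak_ordering k :=
  {| tied := fun a b => tied x ((rho^-1)%g a) ((rho^-1)%g b);
     beats := fun a b => beats x ((rho^-1)%g a) ((rho^-1)%g b) |}.
Next Obligation. by move=> k rho x a b c; exact: tied_equiv. Qed.
Next Obligation. by move=> k rho x a a' b b' /=; exact: beats_tied. Qed.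
Next Obligation. by move=> k rho x a /=; exact: beats_irr. Qed.
Next Obligation. by move=> k rho x b a c /=; exact: beats_trans. Qed.
Next Obligation. by move=> k rho x a b /=; exact: beats_total. Qed.

Inductive outcome := Win | Tie | Loss.

Definition outcome_level (o : outcome) : nat :=
  match o with Win => 2 | Tie => 1 | Loss => 0 end.

Definition outcome_ge (o1 o2 : outcome) : Prop :=
  (outcome_level o2 <= outcome_level o1)%N.

Definition pi_ordering (k : nat) (i j : 'I_k) (x : weak_ordering k) : outcome :=
  if beats x i j then Win else if beats x j i then Loss else Tie.

(* For i != j the value lies in D_k = {1-k, ..., -1, 1, ..., k-1}. *)
Definition pi_ranking (k : nat) (i j : 'I_k) (r : ranking k) : int :=
  (r i)%:Z - (r j)%:Z.

Definition pi_election (V : Type) (k : nat) (i j : 'I_k) (e : V -> ranking k) :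
  V -> int := fun v => pi_ranking i j (e v).

(* [promoted j i r2 r1]: the pair (c_j, c_i) is promoted by (r2, r1). *)
Definition promoted (k : nat) (j i : 'I_k) (r2 r1 : ranking k) : Prop :=
  [/\ i != j,
      forall m, m != i -> m != j -> (r1 m > r1 i)%N -> (r2 m > r2 i)%N,
      forall m, m != i -> m != j -> (r1 j > r1 m)%N -> (r2 j > r2 m)%N,
      (r1 j > r1 i)%N -> (r2 j > r2 i)%N &
      forall m l, m != i -> m != j -> l != i -> l != j ->
        (r1 m > r1 l)%N <-> (r2 m > r2 l)%N].

Definition promoted_election (V : Type) (k : nat) (j i : 'I_k)
    (e2 e1 : V -> ranking k) : Prop :=
  forall v, promoted j i (e2 v) (e1 v).

(* A social welfare function carries its own domain [elections], the set E. *)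
Record SWF d (V : measurableType d) (k : nat) := MkSWF {
  elections : set (V -> ranking k);
  elections_measurable : forall e, elections e -> measurable_fun setT e;
  swf :> elections -> weak_ordering k }.

Section Conditions.
Context d (V : measurableType d) (k : nat).
Implicit Type F : SWF V k.

Definition unrestricted_domain F : Prop :=
  elections F = [set e | measurable_fun setT e].

Definition pi_image F (i j : 'I_k) : set (V -> int) :=
  pi_election i j @` elections F.

Definition MIIA F : Prop :=
  forall i j : 'I_k, i != j ->
    exists f : pi_image F i j -> outcome,
      forall (e : elections F) (a : pi_image F i j),
        val a = pi_election i j (val e) -> f a = pi_ordering i j (F e).

Definition neutrality F : Prop :=
  forall (rho : {perm 'I_k}) (e e' : elections F),
    val e' = (fun v => permute_ranking rho (val e v)) ->
    F e' = permute_ordering rho (F e).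

Definition pareto F : Prop :=
  forall (i j : 'I_k) (e : elections F), i != j ->
    (forall v, 0 < pi_election i j (val e) v) -> pi_ordering i j (F e) = Win.

Definition positive_responsiveness F : Prop :=
  forall (i j : 'I_k) (e1 e2 : elections F),
    promoted_election j i (val e2) (val e1) ->
    outcome_ge (pi_ordering i j (F e1)) (pi_ordering i j (F e2)).

Definition intermediate_value F : Prop :=
  forall (i j : 'I_k) (e1 e2 : elections F),
    promoted_election j i (val e2) (val e1) ->
    pi_ordering i j (F e1) = Win -> pi_ordering i j (F e2) = Loss ->
    exists e' : elections F,
      [/\ promoted_election j i (val e') (val e1),
          promoted_election j i (val e2) (val e') &
          pi_ordering i j (F e') = Tie].

Definition is_tie_rule F : Prop := forall e (i j : 'I_k), tied (F e) i j.

Context (R : realType) (nu : {measure set V -> \bar R}).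

Definition atomless : Prop :=
  forall A : set V, measurable A -> (0 < nu A)%E ->
    exists B : set V, [/\ measurable B, B `<=` A, (0 < nu B)%E & (nu B < nu A)%E].

(* [fine] loses nothing: [nu] is a finite measure wherever [tally] is used. *)
Definition tally (e : V -> ranking k) : ranking k -> R :=
  fun r => fine (nu (e @^-1` [set r])).

Definition anonymity F : Prop :=
  forall e1 e2 : elections F,
    tally (val e1) = tally (val e2) -> F e1 = F e2.

Definition borda_score (w : V -> R) (c : 'I_k) (e : V -> ranking k) : R :=
  \int[nu]_v ((e v c : nat)%:R * w v).

Definition borda (w : V -> R) (e : V -> ranking k) : weak_ordering k :=
  score_ordering (fun c => borda_score w c e).

Definition weakly_borda F : Prop :=
  exists w : V -> R,
    [/\ nu.-integrable setT (EFin \o w),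
        ~ {ae nu, forall v, w v = 0} &
        forall (e : elections F) (i j : 'I_k), i != j ->
          pi_ordering i j (borda w (val e)) <> Tie ->
          pi_ordering i j (F e) = pi_ordering i j (borda w (val e))].

Definition strongly_non_borda F : Prop := ~ weakly_borda F /\ ~ is_tie_rule F.

End Conditions.

(* Main.v *)
Require Import Defs.
From HB Require Import structures.
From mathcomp Require Import all_boot all_order all_fingroup all_algebra.
From mathcomp Require Import all_classical all_reals all_analysis.
From mathcomp Require Import measurable_realfun zify ring lra.

Set Implicit Arguments.
Unset Strict Implicit.
Unset Printing Implicit Defensive.

Import Order.TTheory GRing.Theory Num.Theory.
Import numFieldNormedType.Exports.
(* [Defs.tally] is otherwise shadowed by [seq.tally]. *)
Import Defs.
Local Open Scope classical_set_scope.
Local Open Scope ring_scope.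

(* The six rankings of three candidates fall into two cyclic orders, of masses
   X and Y = 1 - X.  Score the candidates by a Borda count in which a ballot
   weighs 2 + X or 2 + Y according to its cyclic order.  For a given election
   this is a score, hence a weak ordering.  The cyclic order of a ballot can be
   read off its difference r(c_i) - r(c_j): it is one of them for the values
   1, -2 and the other for -1, 2; so the comparison of c_i and c_j depends only
   on the law (l2, l1, g1, g2) of that difference on -2, -1, 1, 2.  It is the
   sign of
     (2 + l2 + g1) (g1 - 2 l2) + (2 + l1 + g2) (2 g2 - l1),
   which increases when mass moves to larger values and is Lipschitz, so the
   intermediate value property follows from the divisibility of an atomless
   measure.

   Suppose this rule is weakly Borda for w.  When the difference is 2 on a set G
   of measure 1/2 and -2 elsewhere the form vanishes, so \int_G w = (\int w) / 2;
   by halving, \int_A w = nu(A) \int w for every A of dyadic measure.  If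
   \int w = 0 this forces w = 0 almost everywhere.  If \int w < 0, unanimous
   elections contradict the Pareto principle; if \int w > 0, consider the law
   (13, 0, 11, 8) / 32, where the form is negative and the Borda margin is
   positive. *)

(** * Borda counts weighted by cyclic orders *)

(* For k = 3 these classes are the cosets of the rotations of {0, 1, 2}, i.e.
   the two cyclic orders of the candidates. *)
Definition same_cycle (k : nat) (r r' : ranking k) : bool :=
  [forall i, forall j, (r i + r' j == r' i + r j %[mod k])%N].

Section EndogenousBorda.
Context (R : realFieldType) (k : nat).
Implicit Types (tau : ranking k -> R) (rho : {perm 'I_k}).

(* 2 is the least constant for which [margin_form_mono] holds. *)
Definition cycle_weight tau (r : ranking k) : R :=
  2 + \sum_(r' | same_cycle r r') tau r'.

Definition cycle_score tau (c : 'I_k) : R :=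
  \sum_r cycle_weight tau r * tau r * (r c)%:R.

Definition margin_mass tau (i j : 'I_k) (x : int) : R :=
  \sum_(r | pi_ranking i j r == x) tau r.

(** A relabelling may exchange the two cyclic orders, but not whether two ballots share one: the
    defining condition runs over all pairs of candidates. *)
Lemma same_cycle_permute rho (r r' : ranking k) :
  same_cycle (permute_ranking rho r) (permute_ranking rho r') = same_cycle r r'.
Proof.
rewrite /same_cycle /permute_ranking.
apply/'forall_forallP/'forall_forallP => H i j.
  by have := H (rho i) (rho j); rewrite !permM !permK.
by rewrite !permM; exact: H.
Qed.

Lemma permute_ranking_bij rho : bijective (permute_ranking (k := k) rho).
Proof.
by exists (permute_ranking rho^-1%g) => r; rewrite /permute_ranking ?invgK ?mulKg ?mulKVg.
Qed.

Lemma cycle_score_permute tau tau' rho (c : 'I_k) :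
  (forall r, tau' (permute_ranking rho r) = tau r) ->
  cycle_score tau' c = cycle_score tau ((rho^-1)%g c).
Proof.
move=> tauE; have bij := permute_ranking_bij rho.
rewrite /cycle_score (reindex _ (onW_bij _ bij)) /=; apply: eq_bigr => r _.
rewrite tauE /cycle_weight (reindex _ (onW_bij _ bij)) /=.
under eq_bigl do rewrite same_cycle_permute.
by under eq_bigr do rewrite tauE; rewrite permM.
Qed.

End EndogenousBorda.

Definition margin_form (R : pzRingType) (l2 l1 g1 g2 : R) : R :=
  (2 + l2 + g1) * (g1 - 2 * l2) + (2 + l1 + g2) * (2 * g2 - l1).

(** * Arithmetic of the rankings of three candidates *)

Lemma third_candidate (i j : 'I_3) : i != j -> exists m, m != i /\ m != j.
Proof.
move: i j => [[|[|[|//]]] ?] [[|[|[|//]]] ?] //= _;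
  by [exists (@Ordinal 3 0 isT)|exists (@Ordinal 3 1 isT)|exists (@Ordinal 3 2 isT)].
Qed.

Lemma ranking3_values (i j m : 'I_3) (r : ranking 3) :
  i != j -> m != i -> m != j ->
  ((r i < 3)%N /\ (r j < 3)%N /\ (r m < 3)%N) /\
  (r i : nat) <> r j /\ (r m : nat) <> r i /\ (r m : nat) <> r j.
Proof.
move=> ij mi mj; rewrite !ltn_ord; do !split=> //.
all: by move=> /val_inj/perm_inj; apply/eqP.
Qed.

Lemma pi_ranking3 (i j : 'I_3) (r : ranking 3) : i != j ->
  pi_ranking i j r \in [:: -2; -1; 1; 2 : int].
Proof.
move=> ij; have [m [mi mj]] := third_candidate ij.
have := ranking3_values r ij mi mj; rewrite /pi_ranking !inE.
lia.
Qed.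

(** Modulo 3 the margins -2 and 1 coincide, and so do -1 and 2. The three values of a ranking are
    distinct modulo 3, so one difference determines the others. *)
Lemma same_cycle3 (i j : 'I_3) (r r' : ranking 3) : i != j ->
  same_cycle r r' =
  ((pi_ranking i j r \in [:: -2; 1]) == (pi_ranking i j r' \in [:: -2; 1])).
Proof.
move=> ij; have [m [mi mj]] := third_candidate ij.
have := ranking3_values r ij mi mj; have := ranking3_values r' ij mi mj.
have E3 (c : 'I_3) : [|| c == i, c == j | c == m].
  move: ij mi mj {r r'}; move: i j m c.
  by do 4!case=> [[|[|[|//]]] ?].
rewrite /pi_ranking !inE => H' H; apply/'forall_forallP/idP => [/(_ i j)|].
  by lia.
move=> d x y; case/or3P: (E3 x) => /eqP ->; case/or3P: (E3 y) => /eqP ->; lia.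
Qed.

(** * Score differences as functions of the law of one margin *)

Section Margin.
Context (R : realFieldType).
Implicit Types (tau : ranking 3 -> R).

(** Ballots are grouped by margin. [G] serves as an indicator for the cycle weights, as a weighted
    margin for the scores, and as 1 for the total mass. *)
Lemma sum_margin tau (G : int -> R) (i j : 'I_3) : i != j ->
  \sum_r G (pi_ranking i j r) * tau r =
  G (-2) * margin_mass tau i j (-2) + G (-1) * margin_mass tau i j (-1) +
  G 1 * margin_mass tau i j 1 + G 2 * margin_mass tau i j 2.
Proof.
move=> ij; rewrite /margin_mass !big_distrr /=.
rewrite [X in X + _ + _ + _]big_mkcond [X in _ + X + _ + _]big_mkcond.
rewrite [X in _ + _ + X + _]big_mkcond [X in _ + _ + _ + X]big_mkcond /=.
rewrite -!big_split /=; apply: eq_bigr => r _.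
have := pi_ranking3 r ij; rewrite !inE.
by case/or4P => /eqP ->; rewrite /= ?(addr0, add0r).
Qed.

Lemma cycle_weight_margin tau (i j : 'I_3) (r : ranking 3) : i != j ->
  cycle_weight tau r = 2 +
    (if pi_ranking i j r \in [:: -2; 1]
     then margin_mass tau i j (-2) + margin_mass tau i j 1
     else margin_mass tau i j (-1) + margin_mass tau i j 2).
Proof.
move=> ij; rewrite /cycle_weight; congr (2 + _).
under eq_bigl do rewrite (same_cycle3 _ _ ij).
set b := (pi_ranking i j r \in _).
rewrite big_mkcond /=.
transitivity (\sum_r' (b == (pi_ranking i j r' \in [:: -2; 1]))%:R * tau r').
  by apply: eq_bigr => r' _; case: (b == _); rewrite ?mul1r ?mul0r.
rewrite (sum_margin tau (fun x => (b == (x \in [:: -2; 1]))%:R) ij).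
by case: b; rewrite /=; ring.
Qed.

Lemma cycle_scoreB tau (i j : 'I_3) : i != j ->
  cycle_score tau i - cycle_score tau j =
  margin_form (margin_mass tau i j (-2)) (margin_mass tau i j (-1))
              (margin_mass tau i j 1) (margin_mass tau i j 2).
Proof.
move=> ij; rewrite /cycle_score -sumrB.
set X := margin_mass tau i j (-2) + margin_mass tau i j 1.
set Y := margin_mass tau i j (-1) + margin_mass tau i j 2.
transitivity (\sum_r (2 + (if pi_ranking i j r \in [:: -2; 1] then X else Y)) *
   (pi_ranking i j r)%:~R * tau r).
  apply: eq_bigr => r _; rewrite (cycle_weight_margin _ _ ij) -/X -/Y.
  by rewrite /pi_ranking rmorphB /=; ring.
rewrite (sum_margin tau
  (fun x => (2 + (if x \in [:: -2; 1] then X else Y)) * x%:~R) ij) /=.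
by rewrite /margin_form /X /Y; ring.
Qed.

(** The last three hypotheses say that the unprimed law stochastically dominates the primed one.
    With [l1] eliminated by total mass, the form is nondecreasing in g2, g2 + g1 and -l2. *)
Lemma margin_form_mono (l2 l1 g1 g2 l2' l1' g1' g2' : R) :
  0 <= l2 -> 0 <= l1 -> 0 <= g1 -> 0 <= g2 -> l2 + l1 + g1 + g2 = 1 ->
  0 <= l2' -> 0 <= l1' -> 0 <= g1' -> 0 <= g2' -> l2' + l1' + g1' + g2' = 1 ->
  g2' <= g2 -> g2' + g1' <= g2 + g1 -> l2 <= l2' ->
  margin_form l2' l1' g1' g2' <= margin_form l2 l1 g1 g2.
Proof.
move=> l20 l10 g10 g20 S l20' l10' g10' g20' S' h2 h1 h0.
(* The form is quadratic, so the difference is its gradient at the midpoint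
   applied to the increment; (a, b, s, t) is twice the midpoint. *)
pose a := l2 + l2'; pose b := l1 + l1'; pose s := g1 + g1'; pose t := g2 + g2'.
have -> : margin_form l2 l1 g1 g2 = margin_form l2' l1' g1' g2' +
  ((4 + b + 4 * t + a - 2 * s) * (g2 - g2') +
   (8 - a + 2 * s - t + 2 * b) * (g2 + g1 - (g2' + g1')) +
   (4 + t - 2 * b + 4 * a + s) * (l2' - l2)) / 2.
  have El1 : l1 = 1 - l2 - g1 - g2 by lra.
  have El1' : l1' = 1 - l2' - g1' - g2' by lra.
  by rewrite /margin_form /a /b /s /t El1 El1'; field.
(* Since a + b + s + t = 2, no coefficient is negative; the first vanishes at s = 2 and the last at
   b = 2. *)
rewrite lerDl divr_ge0 // !addr_ge0 // mulr_ge0 //; rewrite ?/a ?/b ?/s ?/t; lra.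
Qed.

(** The same midpoint expansion, in all four coordinates: each partial derivative is at most 10 in
    absolute value, whence 4 * 10. *)
Lemma margin_form_lip (l2 l1 g1 g2 l2' l1' g1' g2' c : R) :
  0 <= l2 <= 1 -> 0 <= l1 <= 1 -> 0 <= g1 <= 1 -> 0 <= g2 <= 1 ->
  0 <= l2' <= 1 -> 0 <= l1' <= 1 -> 0 <= g1' <= 1 -> 0 <= g2' <= 1 ->
  `|l2' - l2| <= c -> `|l1' - l1| <= c -> `|g1' - g1| <= c -> `|g2' - g2| <= c ->
  `|margin_form l2' l1' g1' g2' - margin_form l2 l1 g1 g2| <= 40 * c.
Proof.
move=> l20 l10 g10 g20 l20' l10' g10' g20' h1 h2 h3 h4.
pose a := l2 + l2'; pose b := l1 + l1'; pose s := g1 + g1'; pose t := g2 + g2'.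
have -> : margin_form l2' l1' g1' g2' - margin_form l2 l1 g1 g2 =
  (8 + b + 4 * t) / 2 * (g2' - g2) + (- 4 + t - 2 * b) / 2 * (l1' - l1) +
  (4 - a + 2 * s) / 2 * (g1' - g1) + (- 8 - 4 * a - s) / 2 * (l2' - l2).
  by rewrite /margin_form /a /b /s /t; field.
have B (x y : R) : -10 <= x <= 10 -> `|y| <= c -> `|x * y| <= 10 * c.
  move=> x10 yc; rewrite normrM ler_pM // ler_norml; lra.
have -> : 40 * c = 10 * c + 10 * c + 10 * c + 10 * c by ring.
rewrite /a /b /s /t; do 3!(apply: (le_trans (ler_normD _ _));
  apply: lerD; last by apply: B => //; lra).
by apply: B => //; lra.
Qed.

End Margin.

(** * Atomless probabilities *)


Lemma exprn_half_lt (R : realType) (e : R) : 0 < e -> exists n, 2^-1 ^+ n < e.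
Proof.
move=> e0; have : (2^-1 : R) ^+ n @[n --> \oo] --> 0.
  by apply: cvg_expr; rewrite ger0_norm ?invr_ge0 // invf_lt1 // ltr1n.
by move=> /cvgr_lt /(_ _ e0) [n _ /(_ n (leqnn n)) /= ?]; exists n.
Qed.

Section RealProbability.
Context (R : realType) d (V : measurableType d) (nu : probability V R).

Definition pr (A : set V) : R := fine (nu A).

Lemma prE A : measurable A -> nu A = (pr A)%:E.
Proof. by move=> mA; rewrite /pr fineK ?fin_num_measure. Qed.

Lemma pr0 : pr set0 = 0.
Proof. by rewrite /pr measure0. Qed.

Lemma prT : pr setT = 1.
Proof. by rewrite /pr probability_setT. Qed.

Lemma pr_ge0 A : 0 <= pr A.
Proof. exact: fine_ge0. Qed.

Lemma le_pr A B : measurable A -> measurable B -> A `<=` B -> pr A <= pr B.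
Proof.
by move=> mA mB AB; rewrite -lee_fin -!prE // le_measure ?inE.
Qed.

Lemma pr_le1 A : measurable A -> pr A <= 1.
Proof. by move=> mA; rewrite -prT le_pr. Qed.

Lemma prU A B : measurable A -> measurable B -> A `&` B = set0 ->
  pr (A `|` B) = pr A + pr B.
Proof.
move=> mA mB AB0; apply: EFin_inj; rewrite EFinD -!prE //; last exact: measurableU.
by rewrite measureU.
Qed.

Lemma prD A B : measurable A -> measurable B -> A `<=` B ->
  pr (B `\` A) = pr B - pr A.
Proof.
move=> mA mB AB; have := @prU A (B `\` A) mA (measurableD mB mA).
rewrite setDIK => /(_ erefl); rewrite setDUK // => ->.
by rewrite addrC addKr.
Qed.

Lemma pr_bigcup_gt (A : nat -> set V) (c : R) :
  (forall n, measurable (A n)) -> (forall n, A n `<=` A n.+1) ->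
  c < pr (\bigcup_n A n) -> exists n, c < pr (A n).
Proof.
move=> mA ndA ltc; have mU : measurable (\bigcup_n A n) by exact: bigcup_measurable.
have : nu \o A @ \oo --> nu (\bigcup_n A n).
  apply: nondecreasing_cvg_mu => //.
  by apply/nondecreasing_seqP => n; apply/subsetPset.
rewrite (prE mU) => /fine_cvg cvA.
have /= := cvgr_gt _ cvA _ ltc.
by move=> [n _ /(_ n (leqnn n)) /= ?]; exists n.
Qed.

(* Greedy exhaustion: each step at least halves the gap to the supremum. *)
Lemma exhaustion (Q : set V -> Prop) : Q set0 ->
  exists A : nat -> set V, [/\ forall n, measurable (A n) /\ Q (A n),
    forall n, A n `<=` A n.+1 &
    forall B, measurable B -> Q B -> \bigcup_n A n `<=` B ->
      pr B <= pr (\bigcup_n A n)].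
Proof.
move=> Q0; pose T := {A : set V | measurable A /\ Q A}.
(* The inequality reads pr B - pr A' <= pr A' - pr A: what remains to be gained is at most what was
   just gained. *)
pose step (A A' : T) := sval A `<=` sval A' /\ forall B, measurable B -> Q B ->
  sval A `<=` B -> pr B <= 2 * pr (sval A') - pr (sval A).
have next (A : T) : {A' : T | step A A'}.
  apply: cid; case: A => A [mA QA]; rewrite /step /=.
  pose S := [set pr B | B in [set B | [/\ measurable B, Q B & A `<=` B]]].
  have SA : S (pr A) by exists A => //; split.
  have hS : has_sup S.
    by split; [exists (pr A)|exists 1 => _ [B [mB _ _] <-]; exact: pr_le1].
  have ubS := sup_upper_bound hS.
  have [le|lt] := leP (sup S) (pr A).
    exists (exist _ A (conj mA QA)); split=> //= B mB QB AB.
    have : pr B <= sup S by apply: ubS; exists B => //; split.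
    by move=> h; have := le_trans h le; lra.
  have e0 : 0 < (sup S - pr A) / 2 by rewrite divr_gt0 // subr_gt0.
  have [_ [B [mB QB AB] <-] ltB] := sup_adherent e0 hS.
  exists (exist _ B (conj mB QB)); split=> //= B' mB' QB' AB'.
  have : pr B' <= sup S by apply: ubS; exists B' => //; split.
  lra.
have [A [_ stepA]] := dependent_choice next (exist _ set0 (conj measurable0 Q0)).
exists (sval \o A); split=> [n|n|B mB QB AB] /=.
- by case: (A n).
- by case: (stepA n).
rewrite leNgt; apply/negP => ltB.
have mA n : measurable (sval (A n)) by case: (A n) => ? [].
have ndA n : sval (A n) `<=` sval (A n.+1) by case: (stepA n).
have mU : measurable (\bigcup_n sval (A n)) by exact: bigcup_measurable.
have subU n : sval (A n) `<=` \bigcup_n sval (A n) by move=> x Ax; exists n.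
(* With U the union, pr B > pr U puts 2 pr U - pr B below pr U. A stage [n] above it gives pr B <= 2
   pr U - pr (A n) < pr B. *)
have [n ltn] :=
  @pr_bigcup_gt _ (pr (\bigcup_n sval (A n)) * 2 - pr B) mA ndA ltac:(lra).
have := (stepA n).2 B mB QB (subset_trans (subU n) AB).
have := le_pr (mA n.+1) mU (subU n.+1).
lra.
Qed.

Hypothesis nu_atomless : atomless nu.

(** Split a set by atomlessness and keep the smaller piece: its measure is at most half. Then
    iterate. *)
Lemma atomless_small A (e : R) : measurable A -> 0 < pr A -> 0 < e ->
  exists B, [/\ measurable B, B `<=` A, 0 < pr B & pr B < e].
Proof.
move=> mA A0 e0.
have half n : exists B, [/\ measurable B, B `<=` A, 0 < pr B & pr B <= 2^-1 ^+ n].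
  elim: n => [|n [B [mB BA B0 Bn]]].
    by exists A; split=> //; rewrite expr0 pr_le1.
  have nuB0 : (0 < nu B)%E by rewrite prE // lte_fin.
  have [C [mC CB C0 CltB]] := nu_atomless mB nuB0.
  have {}C0 : 0 < pr C by rewrite -lte_fin -prE.
  have {}CltB : pr C < pr B by rewrite -lte_fin -!prE.
  rewrite exprS.
  have [leC|ltC] := leP (pr C) (pr B / 2).
    by exists C; split=> //; [exact: subset_trans BA|lra].
  exists (B `\` C); rewrite prD //; split; [exact: measurableD|..|lra|lra].
  by apply: subset_trans BA; exact: subDsetl.
have [n ltn] := exprn_half_lt e0.
have [B [mB BA B0 Bn]] := half n.
by exists B; split=> //; exact: le_lt_trans ltn.
Qed.

(** Exhaust by an increasing sequence of sets with D >= 0 and let A be its union. D A < 0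
    contradicts continuity along the sequence; D A > 0 lets a small piece of the complement be
    added, against maximality. *)
Lemma atomless_ivt (D : set V -> R) (c : R) :
  (forall A B, measurable A -> measurable B -> A `<=` B ->
     `|D B - D A| <= c * pr (B `\` A)) ->
  0 <= D set0 -> D setT <= 0 -> exists2 A, measurable A & D A = 0.
Proof.
move=> lipD D0 DT.
have [F [/all_and2[mF DF] ndF maxF]] := @exhaustion (fun A => 0 <= D A) D0.
set A := \bigcup_n F n in maxF; exists A; first exact: bigcup_measurable.
have mA : measurable A by exact: bigcup_measurable.
have c0 : 0 <= c.
  have := lipD _ _ measurable0 measurableT (sub0set _).
  by rewrite setD0 prT mulr1; exact: le_trans.
have [DA|DA|//] := ltgtP (D A) 0.
  (* The divisor is c + 1 because c may be 0. *)
  have ltA : pr A + D A / (c + 1) < pr A.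
    by rewrite gtrDl pmulr_llt0 // invr_gt0; lra.
  have [n] := pr_bigcup_gt mF ndF ltA.
  have FA : F n `<=` A by exact: bigcup_sup.
  have := lipD _ _ (mF n) mA FA; rewrite prD // ler_norml => /andP[h1 _] h2.
  have := DF n.
  have : c * (pr A - pr (F n)) <= (c + 1) * (pr A - pr (F n)).
    by rewrite ler_wpM2r ?subr_ge0 ?le_pr //; lra.
  have : (c + 1) * (pr A - pr (F n)) < - D A.
    by rewrite mulrC -ltr_pdivlMr ?mulNr; lra.
  lra.
have AT : 0 < pr (~` A).
  rewrite lt0r pr_ge0 andbT; apply/eqP => A0.
  have := lipD _ _ mA measurableT (@subsetT _ A).
  by rewrite setTD A0 mulr0 normr_le0 subr_eq0 => /eqP; lra.
have e0 : 0 < D A / (c + 1) by rewrite divr_gt0 //; lra.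
have [B [mB BA B0 Be]] := atomless_small (measurableC mA) AT e0.
have AB : A `&` B = set0 by apply/disjoints_subset; rewrite -[A]setCK; exact: subsetC.
have := maxF _ (measurableU _ _ mA mB).
rewrite prU // => /(_ _ (@subsetUl _ A B)); apply: contraPP => _ h.
have : pr A + pr B <= pr A; last by lra.
apply: h; have := lipD _ _ mA (measurableU _ _ mA mB) (@subsetUl _ A B).
rewrite setDUl setDv set0U setDidl ?(setIC B) // ler_norml => /andP[h1 _].
have : c * pr B <= (c + 1) * pr B by rewrite ler_wpM2r ?pr_ge0 //; lra.
have : (c + 1) * pr B < D A by rewrite mulrC -ltr_pdivlMr //; lra.
lra.
Qed.

(** Intermediate values of B |-> s - pr (A [&] B), which is 1-Lipschitz. *)
Lemma sierpinski A (s : R) : measurable A -> 0 <= s <= pr A ->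
  exists B, [/\ measurable B, B `<=` A & pr B = s].
Proof.
move=> mA /andP[s0 sA].
have [|||B mB DB] := @atomless_ivt (fun B => s - pr (A `&` B)) 1.
- move=> B C mB mC BC; rewrite mul1r.
  have mAB := measurableI _ _ mA mB; have mAC := measurableI _ _ mA mC.
  have ABC : A `&` B `<=` A `&` C by exact: setIS.
  have := le_pr mAB mAC ABC; have := prD mAB mAC ABC.
  have : pr ((A `&` C) `\` (A `&` B)) <= pr (C `\` B).
    apply: le_pr; try exact: measurableD.
    by move=> x [[Ax Cx] nABx]; split=> // Bx; apply: nABx.
  by rewrite ler_norml; lra.
- by rewrite setI0 pr0 subr0.
- by rewrite setIT subr_le0.
exists (A `&` B); split; [exact: measurableI|exact: subIsetl|lra].
Qed.

End RealProbability.

(** * The rule and its axioms *)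

Definition sign_outcome (R : realDomainType) (x : R) : outcome :=
  if 0 < x then Win else if x < 0 then Loss else Tie.

Lemma sign_outcome_Win (R : realDomainType) (x : R) :
  0 < x -> sign_outcome x = Win.
Proof. by rewrite /sign_outcome => ->. Qed.

Lemma sign_outcome_Loss (R : realDomainType) (x : R) :
  x < 0 -> sign_outcome x = Loss.
Proof. by rewrite /sign_outcome; case: ltgtP. Qed.

Lemma le_sign_outcome (R : realDomainType) (x y : R) :
  x <= y -> outcome_ge (sign_outcome y) (sign_outcome x).
Proof.
rewrite /outcome_ge /sign_outcome => xy.
by case: (ltgtP 0 x); case: (ltgtP 0 y) => //=; lra.
Qed.

Lemma pi_score_ordering (R : realType) k (s : 'I_k -> R) (i j : 'I_k) :
  pi_ordering i j (score_ordering s) = sign_outcome (s i - s j).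
Proof. by rewrite /pi_ordering /sign_outcome /= subr_gt0 subr_lt0. Qed.

Lemma weak_ordering_eq k (x y : weak_ordering k) :
  tied x = tied y -> beats x = beats y -> x = y.
Proof.
case: x y => [t b h1 h2 h3 h4 h5] [t' b' h1' h2' h3' h4' h5'] /= tE bE.
by subst t' b'; f_equal; exact: Prop_irrelevance.
Qed.

(** Whatever is above c_i stays above it and whatever is below c_j stays below it, so the value of
    c_i cannot rise and that of c_j cannot fall. *)
Lemma promoted3_le (i j : 'I_3) (r2 r1 : ranking 3) :
  promoted j i r2 r1 -> pi_ranking i j r2 <= pi_ranking i j r1.
Proof.
case=> ij Hi Hj Hij _; have [m [mi mj]] := third_candidate ij.
have := ranking3_values r1 ij mi mj; have := ranking3_values r2 ij mi mj.
by move: (Hi _ mi mj) (Hj _ mi mj) Hij; rewrite /pi_ranking; lia.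
Qed.

Section CycleRule.
Context (R : realType) d (V : measurableType d) (nu : probability V R).

Lemma measurable_election k (e : V -> ranking k) (P : set (ranking k)) :
  measurable_fun setT e -> measurable (e @^-1` P).
Proof. by move=> me; rewrite -[_ @^-1` _]setTI; exact: me. Qed.

Lemma pr_tally k (e : V -> ranking k) (P : pred (ranking k)) :
  measurable_fun setT e ->
  \sum_(r | P r) tally nu e r = pr nu [set v | P (e v)].
Proof.
move=> me; transitivity (\sum_(r <- enum P) tally nu e r).
  by rewrite big_enum.
transitivity (pr nu [set v | e v \in enum P]); last first.
  by congr pr; apply/seteqP; split=> v /=; rewrite mem_enum.
elim: (enum P) (enum_uniq P) => [_|r s IH /= /andP[rs us]].
  by rewrite big_nil -(pr0 nu); congr pr; apply/seteqP; split.
rewrite big_cons IH //.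
have -> : [set v | e v \in r :: s] = e @^-1` [set r] `|` [set v | e v \in s].
  by apply/seteqP; split=> v /=; rewrite inE => /predU1P.
rewrite prU //; [exact: (@measurable_election _ e [set r])|
  exact: (@measurable_election _ e [set r | r \in s])|].
by apply/seteqP; split=> // v /= [-> ]; rewrite (negPf rs).
Qed.

(** Takes the margin function rather than an election, as MIIA requires. *)
Definition margin (a : V -> int) : R :=
  margin_form (pr nu (a @^-1` [set -2])) (pr nu (a @^-1` [set -1]))
              (pr nu (a @^-1` [set 1])) (pr nu (a @^-1` [set 2])).

Lemma margin_massE (e : V -> ranking 3) (i j : 'I_3) (x : int) : measurable_fun setT e ->
  margin_mass (tally nu e) i j x = pr nu (pi_election i j e @^-1` [set x]).
Proof.
move=> me; rewrite /margin_mass pr_tally //; congr pr.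
by apply/seteqP; split=> v /= /eqP.
Qed.

Lemma cycle_scoreB_margin (e : V -> ranking 3) (i j : 'I_3) : i != j ->
  measurable_fun setT e ->
  cycle_score (tally nu e) i - cycle_score (tally nu e) j =
  margin (pi_election i j e).
Proof. by move=> ij me; rewrite cycle_scoreB // !margin_massE. Qed.

Lemma pi_election3 (e : V -> ranking 3) (i j : 'I_3) v : i != j ->
  pi_election i j e v \in [:: -2; -1; 1; 2 : int].
Proof. exact: pi_ranking3. Qed.

Lemma measurable_pi (e : V -> ranking 3) (i j : 'I_3) (X : set int) : measurable_fun setT e ->
  measurable (pi_election i j e @^-1` X).
Proof. by move=> me; exact: (measurable_election (pi_ranking i j @^-1` X)). Qed.

Lemma pi_mass_sum (e : V -> ranking 3) (i j : 'I_3) : i != j -> measurable_fun setT e ->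
  let a := pi_election i j e in
  pr nu (a @^-1` [set -2]) + pr nu (a @^-1` [set -1]) +
  pr nu (a @^-1` [set 1]) + pr nu (a @^-1` [set 2]) = 1.
Proof.
move=> ij me a; rewrite -!margin_massE //.
have := sum_margin (tally nu e) (fun=> 1) ij; rewrite !mul1r => <-.
under eq_bigr do rewrite mul1r.
by rewrite (pr_tally xpredT me) -(prT nu); congr pr; apply/seteqP; split.
Qed.

(** A pointwise inequality of margins gives stochastic dominance of their laws. *)
Lemma le_margin (e1 e2 : V -> ranking 3) (i j : 'I_3) : i != j ->
  measurable_fun setT e1 -> measurable_fun setT e2 ->
  (forall v, pi_election i j e2 v <= pi_election i j e1 v) ->
  margin (pi_election i j e2) <= margin (pi_election i j e1).
Proof.
move=> ij me1 me2 le21.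
have tail (e : V -> ranking 3) : measurable_fun setT e ->
    pr nu (pi_election i j e @^-1` [set 2]) + pr nu (pi_election i j e @^-1` [set 1]) =
    pr nu (pi_election i j e @^-1` [set x | 0 < x]).
  move=> me; rewrite -prU; try exact: measurable_pi.
    congr pr; apply/seteqP; split=> v /=; first by case=> ->.
    by move: (pi_election3 e v ij); rewrite !inE; lia.
  by apply/seteqP; split=> // v /= [-> ].
apply: margin_form_mono; rewrite ?pr_ge0 ?pi_mass_sum ?tail //.
all: apply: le_pr => //; try exact: measurable_pi.
all: move=> v /=; move: (le21 v) (pi_election3 e1 v ij) (pi_election3 e2 v ij).
all: rewrite !inE; lia.
Qed.

Definition cycle_rule : SWF V 3 :=
  @MkSWF d V 3 [set e | measurable_fun setT e] (fun=> id)
    (fun e => score_ordering (cycle_score (tally nu (val e)))).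

Lemma measurable_val (e : elections cycle_rule) : measurable_fun setT (val e).
Proof. exact: (set_mem (valP e)). Qed.

Lemma pi_cycle_rule (i j : 'I_3) (e : elections cycle_rule) : i != j ->
  pi_ordering i j (cycle_rule e) = sign_outcome (margin (pi_election i j (val e))).
Proof.
by move=> ij; rewrite pi_score_ordering cycle_scoreB_margin //; exact: measurable_val.
Qed.

Lemma cycle_rule_MIIA : MIIA cycle_rule.
Proof.
move=> i j ij; exists (fun a => sign_outcome (margin (val a))) => e a ->.
by rewrite pi_cycle_rule.
Qed.

Lemma cycle_rule_anonymity : anonymity nu cycle_rule.
Proof. by move=> e1 e2 /= ->. Qed.

Lemma cycle_rule_neutrality : neutrality cycle_rule.
Proof.
move=> rho e e' e'E.
have tallyE r : tally nu (val e') (permute_ranking rho r) = tally nu (val e) r.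
  rewrite /tally e'E; congr (fine (nu _)); apply/seteqP; split=> v /= => [|->//].
  exact: (bij_inj (permute_ranking_bij rho)).
have scoreE c := cycle_score_permute c tallyE.
by apply: weak_ordering_eq; apply/funext => a; apply/funext => b /=; rewrite !scoreE.
Qed.

Lemma cycle_rule_pareto : pareto cycle_rule.
Proof.
move=> i j e ij pos; rewrite pi_cycle_rule // /sign_outcome.
have := pi_mass_sum ij (measurable_val e) => /=; rewrite /margin.
set a := pi_election i j (val e) in pos *.
have neg (x : int) : x <= 0 -> pr nu (a @^-1` [set x]) = 0.
  move=> x0; rewrite -(pr0 nu); congr pr; apply/seteqP; split=> // v /= ax.
  by have := pos v; rewrite ax; lia.
rewrite (neg (-2)) // (neg (-1)) //; set s := pr nu _; set t := pr nu _ => st.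
have s0 : 0 <= s by exact: pr_ge0.
have t0 : 0 <= t by exact: pr_ge0.
rewrite /margin_form ifT //.
(* The form becomes (3 - t)(1 - t) + 2 t (2 + t) = 3 + 3 t^2. *)
have -> : s = 1 - t by lra.
nra.
Qed.

(** PR and IV quantify over all [i] and [j], and [promoted] yields [i != j] only at a voter; the
    diagonal is settled separately. *)
Lemma pi_cycle_ruleii (i : 'I_3) (e : elections cycle_rule) :
  pi_ordering i i (cycle_rule e) = Tie.
Proof. by rewrite pi_score_ordering subrr /sign_outcome ltxx. Qed.

Lemma cycle_rule_positive_responsiveness : positive_responsiveness cycle_rule.
Proof.
move=> i j e1 e2 e21; have [->|ij] := eqVneq i j.
  by rewrite !pi_cycle_ruleii.
rewrite !pi_cycle_rule //; apply: le_sign_outcome; apply: le_margin => //.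
- exact: measurable_val.
- exact: measurable_val.
- by move=> v; exact: promoted3_le.
Qed.

(** As [A] grows from the empty set to V, voters switch from [e1] to [e2]; this replaces a path
    between the two elections. *)
Definition paste k (A : set V) (e2 e1 : V -> ranking k) : V -> ranking k :=
  fun v => if v \in A then e2 v else e1 v.

Lemma measurable_paste k (A : set V) (e2 e1 : V -> ranking k) :
  measurable A -> measurable_fun setT e2 -> measurable_fun setT e1 ->
  measurable_fun setT (paste A e2 e1).
Proof.
move=> mA m2 m1; apply: measurable_fun_ifT => //.
apply: (measurable_fun_bool true).
have -> // : setT `&` mem A @^-1` [set true] = A.
by apply/seteqP; split=> v /=; [move=> [_ /set_mem]|move=> /mem_set].
Qed.

Lemma pr_dist (A B C : set V) : measurable A -> measurable B -> measurable C ->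
  (forall v, ~ C v -> A v <-> B v) -> `|pr nu A - pr nu B| <= pr nu C.
Proof.
move=> mA mB mC AB.
have leU X Y : measurable X -> measurable Y -> X `<=` Y `|` C ->
    pr nu X <= pr nu Y + pr nu C.
  move=> mX mY XYC.
  have YCY0 : Y `&` (C `\` Y) = set0 by rewrite setDIK.
  apply: (@le_trans _ _ (pr nu (Y `|` (C `\` Y)))).
    apply: le_pr => //; first exact/measurableU/measurableD.
    move=> v Xv; have [Yv|Yv] := pselect (Y v); [by left|right; split=> //].
    by case: (XYC v Xv).
  rewrite prU //; last exact: measurableD.
  rewrite lerD2l; apply: le_pr => //; exact: measurableD.
have h1 : pr nu A <= pr nu B + pr nu C.
  by apply: leU => // v Av; have [Cv|/AB[+ _]] := pselect (C v); [right|left; auto].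
have h2 : pr nu B <= pr nu A + pr nu C.
  by apply: leU => // v Bv; have [Cv|/AB[_ +]] := pselect (C v); [right|left; auto].
by rewrite ler_norml; lra.
Qed.

Lemma promoted_refl k (j i : 'I_k) (r : ranking k) : i != j -> promoted j i r r.
Proof. by move=> ij; split. Qed.

(** The two pasted elections differ only on B \ A, so each of the four masses moves by at most its
    measure. *)
Lemma paste_lip (e1 e2 : V -> ranking 3) (i j : 'I_3) (A B : set V) : i != j ->
  measurable_fun setT e1 -> measurable_fun setT e2 ->
  measurable A -> measurable B -> A `<=` B ->
  `|margin (pi_election i j (paste B e2 e1)) -
    margin (pi_election i j (paste A e2 e1))| <= 40 * pr nu (B `\` A).
Proof.
move=> ij m1 m2 mA mB AB.
have mpA := measurable_paste mA m2 m1; have mpB := measurable_paste mB m2 m1.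
have p01 (e : V -> ranking 3) (x : int) : measurable_fun setT e ->
    0 <= pr nu (pi_election i j e @^-1` [set x]) <= 1.
  by move=> me; rewrite pr_ge0 pr_le1 //; exact: measurable_pi.
apply: margin_form_lip; rewrite ?p01 //; apply: pr_dist;
  try exact: measurable_pi; try exact: measurableD.
all: move=> v BAv; rewrite /= /pi_election /paste.
all: have -> // : (v \in A) = (v \in B).
all: apply/idP/idP; rewrite !inE; first exact: AB.
all: by move=> Bv; apply: contrapT => Av; apply: BAv.
Qed.

Hypothesis nu_atomless : atomless nu.

(** Every pasted election agrees at each voter with [e1] or [e2], hence lies between them for
    promotion; [atomless_ivt] finds one with margin zero. *)
Lemma cycle_rule_intermediate_value : intermediate_value cycle_rule.
Proof.
move=> i j e1 e2 e21; have [->|ij] := eqVneq i j.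
  by rewrite pi_cycle_ruleii.
have m1 := measurable_val e1; have m2 := measurable_val e2.
rewrite !pi_cycle_rule // => F1 F2.
pose D A := margin (pi_election i j (paste A (val e2) (val e1))).
have D0 : 0 <= D set0.
  have -> : D set0 = margin (pi_election i j (val e1)).
    congr margin; apply/funext => v.
    by rewrite /pi_election /paste in_set0.
  by move: F1; rewrite /sign_outcome; case: ltgtP.
have DT : D setT <= 0.
  have -> : D setT = margin (pi_election i j (val e2)).
    congr margin; apply/funext => v.
    by rewrite /pi_election /paste in_setT.
  by move: F2; rewrite /sign_outcome; case: ltgtP.
have [A mA DA] := atomless_ivt nu_atomless
  (fun A B mA mB => @paste_lip _ _ i j A B ij m1 m2 mA mB) D0 DT.
have me := measurable_paste mA m2 m1.
pose e' : elections cycle_rule := exist _ (paste A (val e2) (val e1)) (mem_set me).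
exists e'; split.
- move=> v /=; rewrite /paste; case: ifP => _; first exact: e21.
  exact: promoted_refl.
- move=> v /=; rewrite /paste; case: ifP => _; last exact: e21.
  exact: promoted_refl.
- by rewrite pi_cycle_rule // DA /sign_outcome ltxx.
Qed.

End CycleRule.

(** * Comparison with Borda rules *)

Section StronglyNonBorda.
Context (R : realType) d (V : measurableType d) (nu : probability V R).
Hypothesis nu_atomless : atomless nu.

(** A zero integral would make f vanish almost everywhere on A, although it is positive there. *)
Lemma Rintegral_gt0 (f : V -> R) (A : set V) : measurable A ->
  nu.-integrable A (EFin \o f) -> (forall v, A v -> 0 < f v) -> 0 < pr nu A ->
  0 < \int[nu]_(v in A) f v.
Proof.
move=> mA intf f0 A0; rewrite lt0r Rintegral_ge0 ?andbT; last first.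
  by move=> v Av; exact/ltW/f0.
apply/eqP => I0; have fA := measurable_int nu intf.
have : (\int[nu]_(v in A) `|(f v)%:E|)%E = 0%E.
  under eq_integral.
    move=> v /set_mem Av; rewrite gee0_abs ?lee_fin; last exact/ltW/f0.
    over.
  by rewrite -[LHS]fineK ?integrable_fin_num // -[fine _]/(\int[nu]_(v in A) f v) I0.
move/(ae_eq_integral_abs nu mA fA) => [N [mN N0 sub]].
have : pr nu A <= pr nu N.
  apply: le_pr => // v Av; apply: sub => /= fv0; case: (fv0 Av) => {}fv0.
  by have := f0 v Av; rewrite fv0 ltxx.
have -> : pr nu N = 0 by rewrite /pr N0.
by move=> /(lt_le_trans A0); rewrite ltxx.
Qed.

(** * Weights whose Borda rule is compatible with the cycle rule *)

Section IntegrableWeight.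
Context (w : V -> R) (int_w : nu.-integrable setT (EFin \o w)).

(** The signed measure with density [w]. *)
Let I (A : set V) : R := \int[nu]_(v in A) w v.

Let int_wS A : measurable A -> nu.-integrable A (EFin \o w).
Proof. by move=> mA; exact: integrableS int_w. Qed.

Let IU A B : measurable A -> measurable B -> A `&` B = set0 ->
  I (A `|` B) = I A + I B.
Proof.
move=> mA mB AB; apply: Rintegral_setU => //; first exact/int_wS/measurableU.
by rewrite disj_set2E AB.
Qed.

Lemma integrable_score k (e : V -> ranking k) (c : 'I_k) :
  measurable_fun setT e ->
  nu.-integrable setT (EFin \o (fun v => (e v c : nat)%:R * w v)).
Proof.
move=> me; pose h v : R := (e v c : nat)%:R.
suff : nu.-integrable setT ((EFin \o h) \* (EFin \o w))%E by apply: eq_integrable.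
apply: integrableMr => //.
  move=> _ Y mY; rewrite setTI.
  exact: (measurable_election (fun r => Y (r c : nat)%:R)).
exists k%:R; split=> // M kM v _ /=; rewrite ger0_norm //.
by apply/ltW/(le_lt_trans _ kM); rewrite ler_nat ltnW.
Qed.

Lemma borda_scoreB k (e : V -> ranking k) (i j : 'I_k) : measurable_fun setT e ->
  borda_score nu w i e - borda_score nu w j e =
  \int[nu]_v ((pi_election i j e v)%:~R * w v).
Proof.
move=> me; rewrite /borda_score -RintegralB //; try exact: integrable_score.
by apply: eq_Rintegral => v _; rewrite /pi_election /pi_ranking rmorphB /= mulrBl.
Qed.

(* The three rankings put candidate 2 above candidate 0 by 2, -2 and 1. *)
Let profile (T A : set V) : V -> ranking 3 :=
  paste T (cst 1%g) (paste A (cst (tperm ord0 ord_max)) (cst (tperm ord0 (inord 1)))).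

Let measurable_profile T A : measurable T -> measurable A ->
  measurable_fun setT (profile T A).
Proof. by move=> mT mA; do 2!(apply: measurable_paste => //). Qed.

Let pi_profile T A v : pi_election ord_max ord0 (profile T A) v =
  if v \in T then 2 else if v \in A then -2 else 1.
Proof.
rewrite /pi_election /profile /paste /pi_ranking.
case: ifP => _ /=; first by rewrite !perm1.
case: ifP => _ /=; first by rewrite tpermL tpermR.
by rewrite tpermL tpermD ?inordK // -val_eqE /= inordK.
Qed.

Let profile_fibre T A : T `&` A = set0 ->
  let a := pi_election ord_max ord0 (profile T A) in
  [/\ a @^-1` [set 2] = T, a @^-1` [set -2] = A,
      a @^-1` [set 1] = ~` (T `|` A) & a @^-1` [set -1] = set0].
Proof.
move=> TA /=; split; apply/seteqP; split=> v /=; rewrite pi_profile.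
all: have TAv : T v -> A v -> False by move=> Tv Av; rewrite -[False]/(set0 v) -TA.
all: have [Tv|nTv] := pselect (T v); rewrite ?(mem_set Tv) ?(memNset nTv).
all: have [Av|nAv] := pselect (A v); rewrite ?(mem_set Av) ?(memNset nAv).
all: by [|tauto].
Qed.

Let profile_margin T A : measurable T -> measurable A -> T `&` A = set0 ->
  margin nu (pi_election ord_max ord0 (profile T A)) =
  margin_form (pr nu A) 0 (1 - pr nu T - pr nu A) (pr nu T).
Proof.
move=> mT mA TA; have [E1 E2 E3 E4] := profile_fibre TA.
rewrite /margin E1 E2 E3 E4 pr0; congr margin_form.
rewrite -setTD prD //; last exact: measurableU.
by rewrite prT prU // opprD addrA.
Qed.

(** The margin integrates to 2 I(T) - 2 I(A) + I(rest), and I(rest) is I(V) - I(T) - I(A). *)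
Let profile_borda T A : measurable T -> measurable A -> T `&` A = set0 ->
  borda_score nu w ord_max (profile T A) - borda_score nu w ord0 (profile T A) =
  I setT + I T - 3 * I A.
Proof.
move=> mT mA TA; rewrite borda_scoreB; last exact: measurable_profile.
have mp := measurable_profile mT mA.
set a := pi_election _ _ _.
have int_a : nu.-integrable setT (EFin \o (fun v => (a v)%:~R * w v)).
  have := integrableB measurableT (integrable_score ord_max mp) (integrable_score ord0 mp).
  apply: eq_integrable => // v _ /=.
  by rewrite -EFinB /a /pi_election /pi_ranking rmorphB /= mulrBl.
have mTA : measurable (T `|` A) by exact: measurableU.
have mC : measurable (~` (T `|` A)) by exact: measurableC.
have fibre X (x : int) : measurable X -> (forall v, X v -> a v = x) ->
    \int[nu]_(v in X) ((a v)%:~R * w v) = x%:~R * I X.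
  move=> mX aX; rewrite -RintegralZl //; last exact: int_wS.
  by apply: eq_Rintegral => v /set_mem Xv; rewrite aX.
have -> : I setT = I T + I A + I (~` (T `|` A)).
  by rewrite -IU // -IU ?setUv ?setICr.
rewrite -(setUv (T `|` A)) Rintegral_setU ?setUv //; last by rewrite disj_set2E setICr.
rewrite Rintegral_setU //; last 2 first.
- exact: integrableS int_a.
- by rewrite disj_set2E TA.
rewrite (fibre T 2) // ?(fibre A (-2)) // ?(fibre (~` (T `|` A)) 1) //.
- by ring.
- move=> v TAv; rewrite /a pi_profile !memNset // => ?; apply: TAv; [right|left] => //.
- move=> v Av; rewrite /a pi_profile (mem_set Av) memNset // => Tv.
  by have : (T `&` A) v by []; rewrite TA.
- by move=> v Tv; rewrite /a pi_profile mem_set.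
Qed.

Hypothesis weak : forall (e : elections (cycle_rule nu)) (i j : 'I_3), i != j ->
  pi_ordering i j (borda nu w (val e)) <> Tie ->
  pi_ordering i j (cycle_rule nu e) = pi_ordering i j (borda nu w (val e)).

(** The hypothesis [weak] enters the argument only through this comparison of two explicit signs. *)
Let weak_profile T A : measurable T -> measurable A -> T `&` A = set0 ->
  let N := I setT + I T - 3 * I A in N != 0 ->
  sign_outcome (margin_form (pr nu A) 0 (1 - pr nu T - pr nu A) (pr nu T)) =
  sign_outcome N.
Proof.
move=> mT mA TA N N0.
have mp := measurable_profile mT mA.
have := @weak (exist _ (profile T A) (mem_set mp)) ord_max ord0 isT.
rewrite pi_cycle_rule // pi_score_ordering /= profile_borda // profile_margin //.
by apply; move: N0; rewrite -/N /sign_outcome; case: ltgtP.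
Qed.

(** With T = G and A its complement the form is zero, so the cycle rule ties and the Borda margin 4
    I(G) - 2 I(V) must vanish. *)
Let I_half G : measurable G -> pr nu G = 2^-1 -> I G = I setT / 2.
Proof.
move=> mG G2; have mC := measurableC mG.
have TE : I setT = I G + I (~` G) by rewrite -IU ?setICr // setUv.
have := weak_profile mG mC (setICr G).
have -> : pr nu (~` G) = 2^-1 by rewrite -setTD prD // prT G2; lra.
rewrite G2 /margin_form [X in sign_outcome X](_ : _ = 0); last by field.
rewrite /= {1}/sign_outcome ltxx; case: eqP => [N0 _|N0 /(_ isT)]; first by lra.
by rewrite /sign_outcome; case: ltgtP => // /esym.
Qed.

(** One set C, disjoint from both, completes A and B to measure 1/2; subtract the two instances of
    [I_half]. *)
Let I_swap A B : measurable A -> measurable B -> A `&` B = set0 ->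
  pr nu A = pr nu B -> I A = I B.
Proof.
move=> mA mB AB prAB; have mU := measurableU _ _ mA mB.
have := pr_le1 nu mU; rewrite prU // => le1.
have [||C [mC CAB prC]] := @sierpinski _ _ _ nu nu_atomless (~` (A `|` B)) (2^-1 - pr nu A).
- exact: measurableC.
- by rewrite -setTD prD // prT prU //; lra.
have AC : A `&` C = set0.
  by apply/seteqP; split=> // v [Av /CAB []]; left.
have BC : B `&` C = set0.
  by apply/seteqP; split=> // v [Bv /CAB []]; right.
have := I_half (measurableU _ _ mA mC); have := I_half (measurableU _ _ mB mC).
rewrite !prU // !IU // prC => h1 h2.
have := h1 ltac:(lra); have := h2 ltac:(lra); lra.
Qed.

(** A disjoint copy B of A has the same I by [I_swap], and the union falls under the previous
    exponent. The exponent starts at 1, where [I_half] applies. *)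
Let I_dyadic n A : measurable A -> pr nu A = 2^-1 ^+ n.+1 ->
  I A = I setT * 2^-1 ^+ n.+1.
Proof.
elim: n A => [|n IH] A mA prA; first by rewrite expr1; exact: I_half.
have p0 : 0 <= (2^-1 : R) ^+ n by rewrite exprn_ge0 // invr_ge0.
have p1 : (2^-1 : R) ^+ n <= 1 by rewrite exprn_ile1 // ?invr_ge0 // invf_le1 // ler1n.
have [||B [mB BA prB]] := @sierpinski _ _ _ nu nu_atomless (~` A) (2^-1 ^+ n.+2).
- exact: measurableC.
- by rewrite -setTD prD // prT prA !exprS; lra.
have AB : A `&` B = set0 by apply/seteqP; split=> // v [Av /BA].
have := IH _ (measurableU _ _ mA mB).
rewrite prU // IU // -(I_swap mA mB AB) ?prA ?prB // !exprS => h.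
have := h ltac:(lra); lra.
Qed.

Let I_dyadic_mul n k A : measurable A -> pr nu A = k.+1%:R * 2^-1 ^+ n.+1 ->
  I A = I setT * pr nu A.
Proof.
move=> + prA; rewrite prA; elim: k A prA => [|k IH] A prA mA.
  by move: prA; rewrite mul1r => /(I_dyadic mA).
have p0 : 0 <= (2^-1 : R) ^+ n.+1 by rewrite exprn_ge0 // invr_ge0.
have [||B [mB BA prB]] := @sierpinski _ _ _ nu nu_atomless A (2^-1 ^+ n.+1) => //.
  by rewrite p0 prA ler_peMl // ler1n.
have mD := measurableD mA mB.
have BD : B `&` (A `\` B) = set0 by rewrite setDIK.
have := IH (A `\` B); rewrite prD // prA prB => /(_ _ mD) h.
rewrite -(setDUK BA) IU // (I_dyadic mB prB) h; last by rewrite -[in LHS]natr1; ring.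
by rewrite -[in RHS]natr1; ring.
Qed.

(** Otherwise A contains a set of positive dyadic measure, on which I vanishes while w has strict
    sign. *)
Let I_null A : measurable A -> I setT = 0 ->
  (forall v, A v -> 0 < w v) \/ (forall v, A v -> w v < 0) -> pr nu A = 0.
Proof.
move=> mA m0 sgn; apply/eqP; rewrite eq_le pr_ge0 andbT leNgt; apply/negP => A0.
have [n ltn'] := exprn_half_lt A0.
have ltn : (2^-1 : R) ^+ n.+1 < pr nu A.
  have p0 : 0 <= (2^-1 : R) ^+ n by rewrite exprn_ge0 // invr_ge0.
  by rewrite exprS; lra.
have p0 : 0 < (2^-1 : R) ^+ n.+1 by rewrite exprn_gt0 // invr_gt0.
have [||B [mB BA prB]] := @sierpinski _ _ _ nu nu_atomless A (2^-1 ^+ n.+1) => //.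
  by rewrite (ltW p0) (ltW ltn).
have := I_dyadic mB prB; rewrite m0 mul0r => IB.
case: sgn => sgn.
  have := @Rintegral_gt0 w B mB (int_wS mB) (fun v Bv => sgn v (BA v Bv)).
  by rewrite -/(I B) IB ltxx prB => /(_ p0).
have intN : nu.-integrable B (EFin \o (fun v => -1 * w v)).
  have := integrableZl mB (-1) (int_wS mB).
  by apply: eq_integrable.
have := @Rintegral_gt0 _ B mB intN _.
rewrite RintegralZl //; last exact: int_wS.
rewrite -/(I B) IB mulr0 ltxx prB => h; suff : false by []; apply: h => //.
by move=> v Bv; rewrite mulN1r oppr_gt0; exact/sgn/BA.
Qed.

Lemma weight_ae0 : {ae nu, forall v, w v = 0}.
Proof.
have mw : measurable_fun setT w by apply/measurable_EFinP; exact: measurable_int int_w.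
have mP : measurable (w @^-1` `]0, +oo[) by rewrite -[_ @^-1` _]setTI; exact: mw.
have mN : measurable (w @^-1` `]-oo, 0[) by rewrite -[_ @^-1` _]setTI; exact: mw.
have [m0|m0|m0] := ltgtP (I setT) 0.
(* I(V) < 0: when all margins are 2, the form is 6 but the Borda margin is 2 I(V). *)
- have := weak_profile measurableT measurable0 (setI0 setT).
  have -> : I set0 = 0 by exact: Rintegral_set0.
  rewrite prT pr0 /margin_form => /(_ ltac:(lra)).
  by rewrite sign_outcome_Win ?sign_outcome_Loss //; lra.
(* I(V) > 0: masses 8/32 at 2, 13/32 at -2 and 11/32 at 1. The Borda margin is I(V) / 32, while the
   form is (88 * (-15) + 72 * 16) / 32^2 = -168 / 1024, since the cyclic order of -2 and 1 weighs
   more. *)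
- have [||T [mT _ prTE]] := @sierpinski _ _ _ nu nu_atomless setT (8%:R * 2^-1 ^+ 5).
  + exact: measurableT.
  + by rewrite prT !exprS expr0; lra.
  have [||A [mA AT prA]] := @sierpinski _ _ _ nu nu_atomless (~` T) (13%:R * 2^-1 ^+ 5).
  + exact: measurableC.
  + by rewrite -setTD prD // prT prTE !exprS expr0; lra.
  have TA : T `&` A = set0 by apply/seteqP; split=> // v [Tv /AT].
  have := weak_profile mT mA TA.
  rewrite (I_dyadic_mul mT prTE) (I_dyadic_mul mA prA) prTE prA.
  rewrite /margin_form !exprS expr0.
  move=> /(_ ltac:(lra)).
  by rewrite sign_outcome_Loss ?sign_outcome_Win //; lra.
(* I(V) = 0: the sets where w is positive and where it is negative are both null. *)
exists (w @^-1` `]0, +oo[ `|` w @^-1` `]-oo, 0[); split.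
- exact: measurableU.
- change (nu (w @^-1` `]0, +oo[ `|` w @^-1` `]-oo, 0[) = 0%E).
  rewrite prE ?prU //; last 2 first.
  + by apply/seteqP; split=> // v /=; rewrite !in_itv /= andbT => -[]; lra.
  + exact: measurableU.
  congr EFin; rewrite (I_null mP m0) ?(I_null mN m0) ?addr0 //.
  + by right=> v /=; rewrite in_itv.
  + by left=> v /=; rewrite in_itv /= andbT.
- move=> v /= /eqP; rewrite neq_lt => /orP[]; rewrite !in_itv /= ?andbT; auto.
Qed.

End IntegrableWeight.
Lemma cycle_rule_strongly_non_borda : strongly_non_borda nu (cycle_rule nu).
Proof.
split=> [[w [int_w w0 weak]]|tie]; first exact/w0/(weight_ae0 int_w).
(* The tie rule is excluded by Pareto at a unanimous election. *)
have mc : measurable_fun setT (cst 1%g : V -> ranking 3) by [].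
pose e : elections (cycle_rule nu) := exist _ (cst 1%g) (mem_set mc).
have : pi_ordering ord_max ord0 (cycle_rule nu e) = Win.
  by apply: cycle_rule_pareto => // v /=; rewrite /pi_election /pi_ranking !perm1.
have := tie e ord_max ord0; rewrite pi_score_ordering /= => /eqP ->.
by rewrite subrr /sign_outcome ltxx.
Qed.

End StronglyNonBorda.

Theorem mainTheorem1 (R : realType) (d : measure_display)
    (V : measurableType d) (nu : probability V R)
    (V_infinite : infinite_set [set: V]%classic) (nu_atomless : atomless nu) :
  exists F : SWF V 3,
    strongly_non_borda nu F /\
    unrestricted_domain F /\ MIIA F /\ anonymity nu F /\ neutrality F /\
    pareto F /\ positive_responsiveness F /\ intermediate_value F.
Proof.
exists (cycle_rule nu); split; first exact: cycle_rule_strongly_non_borda.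
split; first by [].
split; first exact: cycle_rule_MIIA.
split; first exact: cycle_rule_anonymity.
split; first exact: cycle_rule_neutrality.
split; first exact: cycle_rule_pareto.
split; first exact: cycle_rule_positive_responsiveness.
exact: cycle_rule_intermediate_value.
Qed.
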